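(* Let $\mathcal{C}$ be a variety of finite groups, let $\mathbf{m}$ be an infinite cardinal, and let $F_{\mathcal{C}}(\mathbf{m})$ be a free pro-$\mathcal{C}$ group of infinite rank $\mathbf{m}$. Then $F_{\mathcal{C}}(\mathbf{m})$ admits a noncontinuous epimorphism (of abstract groups) $F_{\mathcal{C}}(\mathbf{m})\to F_{\mathcal{C}}(\mathbf{m})$.
   Context: A variety of finite groups is a collection of finite groups closed under taking subgroups, quotients and finite direct products. A pro-$\mathcal{C}$ group is an inverse limit of groups in $\mathcal{C}$. The free pro-$\mathcal{C}$ group of rank $\mathbf{m}$ is the free pro-$\mathcal{C}$ group on a set $X$ converging to $1$ with $|X|=\mathbf{m}$: it is a pro-$\mathcal{C}$ group $F$ with a continuous pointed map $i:X\cup\{\ast\}\to F$ from the one-point compactification of the discrete space $X$ (with $\ast\mapsto 1$), such that for every continuous pointed map $f:X\cup\{\ast\}\to H$ to a pro-$\mathcal{C}$ group $H$ (with $\ast\mapsto 1$) there is a unique continuous homomorphism $\bar f:F\to H$ with $f=\bar f\circ i$.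
   Formalization: The variety is assumed to contain a nontrivial group: for the variety of trivial groups the free pro-C group is trivial and has no noncontinuous epimorphism onto itself, so the statement fails there. *)

(* Defs.v *)
From HB Require Import structures.
From mathcomp Require Import all_boot all_order all_fingroup.
From mathcomp Require Import all_classical topology.

Set Implicit Arguments.
Unset Strict Implicit.
Unset Printing Implicit Defensive.

Local Open Scope classical_set_scope.
Local Open Scope group_scope.

HB.mixin Record Group_isTopologicalGroup G & monoid.Group G & Topological G := {
  mulg_continuous : continuous (fun x : G * G => x.1 * x.2);
  invg_continuous : continuous (fun x : G => x^-1)
}.

#[short(type="topologicalGroupType")]
HB.structure Definition TopologicalGroup :=
  {G of Group_isTopologicalGroup G & monoid.Group G & Topological G}.

(* A class of finite groups contains all isomorphic copies of its members.
   The empty product is allowed, so a variety contains the trivial group. *)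
Record group_variety (C : finGroupType -> Prop) : Prop := GroupVariety {
  variety_isog : forall gT rT : finGroupType,
    [set: gT]%SET \isog [set: rT]%SET -> C gT -> C rT;
  variety_sub : forall (gT : finGroupType) (H : {group gT}), C gT -> C (subg_of H);
  variety_quot : forall (gT : finGroupType) (N : {group gT}),
    N <| [set: gT]%SET -> C gT -> C (coset_of N);
  variety_prod : forall (I : finType) (gT : I -> finGroupType),
    (forall i, C (gT i)) -> C {dffun forall i, gT i}
}.

Record inverse_system (C : finGroupType -> Prop) := InverseSystem {
  idx_disp : Order.disp_t;
  idx : porderType idx_disp;
  idx_inhabited : inhabited idx;
  idx_directed : forall i j : idx, exists k, (i <= k)%O /\ (j <= k)%O;
  obj : idx -> finGroupType;
  obj_in : forall i, C (obj i);
  trans : forall i j : idx, (i <= j)%O -> obj j -> obj i;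
  transM : forall i j (ij : (i <= j)%O), {morph trans ij : x y / x * y};
  trans_id : forall i (ii : (i <= i)%O) x, trans ii x = x;
  trans_comp : forall i j k (ij : (i <= j)%O) (jk : (j <= k)%O) (ik : (i <= k)%O) x,
    trans ij (trans jk x) = trans ik x
}.

(* The product of the finite groups of the system, each with the discrete topology. *)
Definition ambient C (S : inverse_system C) : topologicalType :=
  prod_topology (fun i : idx S => discrete_topology (obj i)).

Definition threads C (S : inverse_system C) : set (ambient S) :=
  [set x | forall (i j : idx S) (ij : (i <= j)%O), trans ij (x j) = x i].
Arguments threads {C} S _.

(* G is isomorphic, as a topological group, to the group of threads with the
   subspace topology: the last clause says that f is a homeomorphism onto its range. *)
Definition is_inverse_limit C (S : inverse_system C) (G : topologicalGroupType) : Prop :=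
  exists f : G -> ambient S,
    [/\ forall i, {morph (fun g => f g i : obj i) : x y / x * y},
        set_bij [set: G] (threads S) f
      & forall U : set G, open U <-> exists2 V : set (ambient S), open V & U = f @^-1` V].

Definition pro_group (C : finGroupType -> Prop) (G : topologicalGroupType) : Prop :=
  exists S : inverse_system C, is_inverse_limit S G.

(* None is the point at infinity of the one-point compactification. *)
Definition is_free_pro_group (C : finGroupType -> Prop) (X : discreteTopologicalType)
    (F : topologicalGroupType) (iota : one_point_compactification X -> F) : Prop :=
  [/\ pro_group C F, continuous iota, iota None = 1
    & forall (H : topologicalGroupType) (f : one_point_compactification X -> H),
        pro_group C H -> continuous f -> f None = 1 ->
        exists! h : F -> H,
          [/\ continuous h, {morph h : x y / x * y} & f = h \o iota]].

(* Main.v *)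
(* X contains countably many disjoint copies of itself: fix an injection
   e : X * nat -> X.  The universal property gives continuous endomorphisms
   b n : y |-> e (y, n) and a n, sending e (y, n) to y and every other generator
   to 1, with a n \o b n = id and a n \o b m = 1 for n <> m.  Along a
   nonprincipal ultrafilter U on nat, compactness allows one to put
   phi f = lim_U a n f, which is a homomorphism.  It is onto: if h is the limit
   along U of b 0 f * ... * b (N - 1) f, then a n h = f for all n.  But phi kills
   every generator, so it would be trivial if it were continuous. *)
Require Import Defs.
From HB Require Import structures.
From mathcomp Require Import all_boot all_order all_fingroup.
From mathcomp Require Import all_classical topology.

Set Implicit Arguments.
Unset Strict Implicit.
Unset Printing Implicit Defensive.

Local Open Scope classical_set_scope.
Local Open Scope group_scope.

(** * An injection of [X * nat] into an infinite [X] *)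

Lemma infinite_set_inj (T : Type) (A : set T) :
  infinite_set A -> exists2 s : nat -> T, injective s & forall n, A (s n).
Proof.
move=> /infiniteP/card_leP[s].
have sT (n : nat) : n \in [set: nat] by exact: mem_set.
exists (fun n => val (s (SigSub (sT n)))); last by move=> n; exact/set_mem/valP.
move=> m n /val_inj smn.
by have /(congr1 val) := @inj _ _ _ s _ _ (in_setT _) (in_setT _) smn.
Qed.

(* [b x] need not contain [x]: the finitely many points missed by a maximal
   disjoint family of countably infinite sets are all sent to the same block. *)
Lemma infinite_countable_partition (T : Type) : infinite_set [set: T] ->
  exists b : T -> set T,
    [/\ forall x, infinite_set (b x),
        forall x y z, b x z -> b y z -> b x = b y
      & forall x, countable [set y | b y = b x]].
Proof.
move=> infT; pose D := [set B : set T | infinite_set B /\ countable B].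
have [M [MD tM maxM]] := ex_maximal_disjoint_subcollection id D.
pose R := ~` (\bigcup_(B in M) B).
(* Infinitely many missed points would contain the range of an injective sequence, which could be
   added to [M] against maximality. *)
have finR : finite_set R.
  apply: contrapT => /infinite_set_inj[s s_inj Rs].
  apply: (maxM (M `|` [set range s])).
  - split; first by move=> ? ?; left.
    move=> /(_ (range s) (or_intror erefl)) Ms.
    by apply: (Rs 0%N); exists (range s) => //; exists 0%N.
  - move=> B [/MD//|->]; split.
      apply/infiniteP; rewrite (card_le_eqr (inj_card_eq (in2W s_inj))).
      exact: card_lexx.
    exact: card_image_le.
  - move=> A B [MA|->] [MB|->] //=; first exact: tM.
      by case=> z [Az [n _ sz]]; case: (Rs n); exists A => //; rewrite sz.
    by case=> z [[n _ sz] Bz]; case: (Rs n); exists B => //; rewrite sz.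
have [B0 MB0] : M !=set0.
  apply/set0P/eqP => M0; apply: infT; apply: sub_finite_set finR => x _.
  by rewrite /R M0 bigcup_set0.
have /choice[b bP] x : exists B, M B /\ ((\bigcup_(B in M) B) x -> B x).
  have [[B MB Bx]|nx] := pselect ((\bigcup_(B in M) B) x); first by exists B.
  by exists B0.
exists b; split.
- by move=> x; have [/MD[]] := bP x.
- by move=> x y z bx bY; apply: tM; [exact: (bP x).1|exact: (bP y).1|exists z].
(* A covered [y] lies in its own block [b y], which is [b x] here; any other [y] lies in the finite
   set [R]. *)
- move=> x; apply: (@sub_countable _ _ _ (b x `|` R)); last first.
    rewrite -bigcup2E; apply: bigcup_countable => // -[|[|i]] _ /=.
    - by have [/MD[]] := bP x.
    - exact: finite_set_countable.
    - exact: countable0.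
  apply: subset_card_le => y /= byx.
  have [uy|] := pselect ((\bigcup_(B in M) B) y); last by right.
  by left; rewrite -byx; apply: (bP y).2.
Qed.

(** Only countably many [x] share a block, so the pairs [(x, n)] over that block can be enumerated
    and injected into it; distinct blocks are disjoint, so these injections glue. *)
Lemma infinite_prod_nat_inj (T : Type) : infinite_set [set: T] ->
  exists e : T * nat -> T, injective e.
Proof.
move=> /infinite_countable_partition[b [binf bdisj bcount]].
have /choice[e eP] (B : set T) : exists e : T * nat -> T,
    forall x, b x = B -> forall n,
    B (e (x, n)) /\ forall y m, b y = B -> e (x, n) = e (y, m) -> (x, n) = (y, m).
  have [[x0 <-]|nB] := pselect (exists x, b x = B); last first.
    (* No point has block [B], so the condition is vacuous and [fst] is a dummy value. *)
    by exists fst => x bx; case: nB; exists x.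
  have /countable_injP[c cI] := bcount x0.
  have [s sI sB] := infinite_set_inj (binf x0).
  exists (fun p => s (pickle (c p.1, p.2))) => x bx n; split; first exact: sB.
  move=> y m bY /sI/(pcan_inj (@pickleK _))[cxy ->].
  by rewrite (cI x y _ _ cxy) ?inE.
exists (fun p => e (b p.1) p) => -[x n] [y m] /= exy.
have [bx _] := eP _ x erefl n; have [bY _] := eP _ y erefl m.
have bxy : b x = b y by apply: bdisj bx _; rewrite exy.
by have [_] := eP _ x erefl n; apply=> //; rewrite exy bxy.
Qed.

(** * Pro-C groups are compact and Hausdorff *)

Lemma threads_closed C (S : inverse_system C) : closed (threads S).
Proof.
have -> : threads S = \bigcap_(p in [set: idx S * idx S])
    [set x : ambient S | forall ij : (p.1 <= p.2)%O, trans ij (x p.2) = x p.1].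
  apply/seteqP; split=> x /= xS.
    by case=> i j _ ij; exact: xS.
  by move=> i j; exact: (xS (i, j) I).
apply: (@closed_bigI (ambient S)) => -[i j] _ /=.
have [ij|nij] := pselect (i <= j)%O; last first.
  by rewrite (_ : mkset _ = setT); [exact: closedT|apply/seteqP; split=> // x _ ij].
pose pr k (x : ambient S) : discrete_topology (@obj _ S k) := x k.
have pc k : continuous (pr k).
  exact: (@proj_continuous _ (fun k => discrete_topology (@obj _ S k)) k).
(* Splitting by the value [a] at [j] gives a finite union of sets closed by continuity of two
   projections. *)
rewrite (_ : mkset _ = \bigcup_(a in [set: @obj _ S j])
    (pr j @^-1` [set a] `&` pr i @^-1` [set trans ij a])); last first.
  apply/seteqP; split => x /=.
    by move=> xij; exists (x j) => //; split=> //=; rewrite /pr xij.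
  by case=> a _ [xj xi] ij'; rewrite (Prop_irrelevance ij' ij) (xj : x j = a).
apply: closed_bigcup; first exact: finite_finset.
by move=> a _; apply: closedI; apply: preimage_closed => //;
  do ?[by move=> x _; exact: pc|exact: discrete_closed].
Qed.

Lemma threads_compact C (S : inverse_system C) : compact (threads S).
Proof.
pose T i := discrete_topology (@obj _ S i).
have cT : compact [set f : ambient S | forall i, [set: T i] (f i)].
  by apply: (@tychonoff _ T (fun=> setT)) => i;
    apply: finite_compact; exact: finite_finset.
by apply: (subclosed_compact (@threads_closed _ S) cT) => x _ i.
Qed.

Lemma pro_group_compact C (G : topologicalGroupType) : pro_group C G -> compact [set: G].
Proof.
move=> [S [f [_ [fS _ fsurj] fopen]]] A PA _.
have [|_ [/fsurj[g _ <-] clg]] := @threads_compact _ S (f @ A) _.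
  suff : A (f @^-1` threads S) by [].
  by apply: filterS (@filterT _ A _) => x _; exact: fS.
exists g; split=> // U V AU; rewrite nbhsE => -[O [oO Og] OV].
have [W oW OW] := (fopen O).1 oO.
have [| |_ [[x Ux <-] Wx]] := clg (f @` U) W.
- suff : A (f @^-1` (f @` U)) by [].
  by apply: filterS AU; exact: preimage_image.
- by apply: open_nbhs_nbhs; split=> //; rewrite OW in Og.
- by exists x; split=> //; apply: OV; rewrite OW.
Qed.

Lemma pro_group_hausdorff C (G : topologicalGroupType) :
  pro_group C G -> hausdorff_space G.
Proof.
move=> [S [f [_ [_ finj _] fopen]]] x y xy.
apply: finj; rewrite ?inE//.
apply: (@hausdorff_product _ (fun i => discrete_topology (@obj _ S i))).
  by move=> i; exact: discrete_hausdorff.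
have fc : continuous f by apply/continuousP => V oV; apply/fopen; exists V.
by move=> A B /fc Ax /fc By; have [z [Az Bz]] := xy _ _ Ax By; exists (f z).
Qed.

(** * Ultrafilter limits and maps from the one-point compactification *)

Lemma ultra_cvg (I : Type) (T : topologicalType) (U : set_system I) (f : I -> T) :
  UltraFilter U -> compact [set: T] -> exists p : T, f @ U --> p.
Proof.
move=> UU cT; have [|p [_ clp]] := cT (f @ U); first exact: filterT.
exists p => V pV; have [//|nV] := in_ultra_setVsetC (f @^-1` V) UU.
have [x [nx xV]] := clp (~` V) V nV pV.
by case: nx.
Qed.

(** An injective sequence in [K] would have a cluster point [p], yet it leaves the open set
    [[set p]] after at most one visit. *)
Lemma discrete_compact_finite (X : discreteTopologicalType) (K : set X) :
  compact K -> finite_set K.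
Proof.
move=> cK; apply: contrapT => /infinite_set_inj[s s_inj sK].
have [|p [_ clp]] := cK (fmap s \oo); first by exists 0%N => // n _; exact: sK.
have sp : \forall n \near \oo, (~` [set p]) (s n).
  have [[N sN]|nsN] := pselect (exists N, s N = p); last first.
    by apply: nearW => n sn; apply: nsN; exists n.
  exists N.+1 => // n /= Nn; rewrite -sN => /s_inj nN.
  by rewrite nN ltnn in Nn.
by have [x [/= nxp xp]] := clp _ _ sp (discrete_set1 p).
Qed.

(** Points of [X] are isolated, so only infinity matters; its neighborhoods have finite
    complement. *)
Lemma opc_continuousP (X : discreteTopologicalType) (T : topologicalType)
    (f : one_point_compactification X -> T) :
  continuous f <->
  (forall V, nbhs (f None) V -> finite_set [set x | ~ V (f (Some x))]).
Proof.
split=> [fc V /fc [K [cK _] KV]|fV].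
  apply: sub_finite_set (discrete_compact_finite cK) => x /= nVx.
  by apply: contrapT => nKx; apply: nVx; apply: KV; left; exists x.
move=> [x|] V fxV.
  apply: (@filterS _ _ _ [set Some x]).
    by move=> _ ->; exact: nbhs_singleton fxV.
  by apply: filterS (discrete_set1 x) => y ->.
exists [set x | ~ V (f (Some x))].
  by split; [exact/finite_compact/fV|exact: discrete_closed].
move=> _ [[x /= nnV <-]|-> /=]; first exact: contrapT.
exact: nbhs_singleton fxV.
Qed.

(** [s] is a partial injection, undefined points going to infinity; preimages of finite subsets of
    [X] stay finite. *)
Lemma opc_continuous_comp (X : discreteTopologicalType) (T : topologicalType)
    (f : one_point_compactification X -> T) (s : X -> option X) :
  (forall x y z, s x = Some z -> s y = Some z -> x = y) ->
  continuous f -> continuous (f \o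
    (obind s : one_point_compactification X -> one_point_compactification X)).
Proof.
move=> s_inj /opc_continuousP fc; apply/opc_continuousP => V /= fV.
set B := Some @` [set y | ~ V (f (Some y))].
have finB : finite_set (s @^-1` B).
  apply: finite_preimage; last exact: finite_image (fc V fV).
  move=> x y /set_mem[z _ sx] /set_mem[t _ sy] sxy.
  by apply: (s_inj _ _ z); rewrite -?sxy.
apply: sub_finite_set finB => x /= nV; rewrite /B /=.
by case: (s x) nV => [y|] nV; [exists y|case: nV; exact: nbhs_singleton fV].
Qed.

(** * Finite discrete groups as pro-C groups *)

HB.instance Definition _ (gT : finGroupType) :=
  monoid.Group.copy (discrete_topology gT) gT.

Lemma discrete_mulg_continuous (gT : finGroupType) :
  continuous (fun x : discrete_topology gT * discrete_topology gT => x.1 * x.2).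
Proof.
move=> [x y] U Uxy; exists ([set x], [set y]).
  by split; exact: discrete_set1.
by move=> [a b] [/= -> ->]; exact: nbhs_singleton Uxy.
Qed.

Lemma discrete_invg_continuous (gT : finGroupType) :
  continuous (fun x : discrete_topology gT => x^-1).
Proof.
move=> x U Ux; apply: (@filterS _ (nbhs x) _ [set x]); last exact: discrete_set1.
move=> _ ->.
exact: nbhs_singleton Ux.
Qed.

HB.instance Definition _ (gT : finGroupType) :=
  Group_isTopologicalGroup.Build (discrete_topology gT)
    (@discrete_mulg_continuous gT) (@discrete_invg_continuous gT).

(* nat serves as the index set because unit carries no canonical order. *)
Section ConstantSystem.
Variables (C : finGroupType -> Prop) (gT : finGroupType) (gC : C gT).

Let nat_directed (i j : nat) : exists k : nat, (i <= k)%O /\ (j <= k)%O.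
Proof. by exists (maxn i j); rewrite !leEnat leq_maxl leq_maxr. Qed.

Definition constant_system : inverse_system C :=
  @InverseSystem C _ nat (inhabits 0%N) nat_directed (fun=> gT) (fun=> gC)
    (fun _ _ _ => id) (fun _ _ _ _ _ => erefl) (fun _ _ _ => erefl)
    (fun _ _ _ _ _ _ _ => erefl).

Lemma discrete_pro_group : pro_group C (discrete_topology gT).
Proof.
pose pr (x : ambient constant_system) : discrete_topology gT := x 0%N.
exists constant_system; exists (fun g _ => g); split=> //.
- split=> [//|x y _ _ /(congr1 pr)//|x xS].
  exists (pr x) => //; apply: functional_extensionality_dep => n.
  (* Transition maps are identities, so a thread is constant and coordinate 0 determines it. *)
  exact: esym (xS 0%N n (leq0n n)).
- move=> U; split=> [_|_]; last exact: discrete_open.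
  exists (pr @^-1` U) => //.
  have : continuous pr.
    exact: (@proj_continuous nat (fun=> discrete_topology gT) 0%N).
  by move=> /continuousP; apply; exact: discrete_open.
Qed.
End ConstantSystem.

Lemma morphM1 (G H : groupType) (h : G -> H) : {morph h : x y / x * y} -> h 1 = 1.
Proof. by move=> hM; apply: (mulgI (h 1)); rewrite -hM !mulg1. Qed.

(** * Homomorphisms out of a free pro-C group *)

Section FreeProGroup.
Variables (C : finGroupType -> Prop) (X : discreteTopologicalType).
Variables (F : topologicalGroupType) (iota : one_point_compactification X -> F).
Hypothesis freeF : is_free_pro_group C iota.

Lemma free_pro_hom_unique (h k : F -> F) :
  continuous h -> {morph h : x y / x * y} ->
  continuous k -> {morph k : x y / x * y} ->
  (forall x : X, h (iota (Some x)) = k (iota (Some x))) -> h = k.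
Proof.
move=> hc hM kc kM hk; have [proF iotac iota1 univ] := freeF.
have [||l [_ lU]] := univ F (h \o iota) proF.
- by move=> x; apply: continuous_comp; [exact: iotac|exact: hc].
- by rewrite /= iota1 morphM1.
have hkE : h \o iota = k \o iota.
  by apply/funext => -[x|] /=; [exact: hk|rewrite iota1 !morphM1].
by rewrite -(lU h) ?(lU k).
Qed.

(** Partial injections of the basis extend to endomorphisms; generators with [s x = None] are
    killed, since [iota None = 1]. *)
Lemma free_pro_endo (s : X -> option X) :
  (forall x y z, s x = Some z -> s y = Some z -> x = y) ->
  exists h : F -> F, [/\ continuous h, {morph h : x y / x * y}
    & forall x, h (iota (Some x)) = iota (s x)].
Proof.
move=> s_inj; have [proF iotac iota1 univ] := freeF.
have [//|h [[hc hM hE] _]] := univ F _ proF (opc_continuous_comp s_inj iotac).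
by exists h; split=> // x; rewrite -[LHS]/((h \o iota) (Some x)) -hE.
Qed.

(** Sending [x0] to some [c != 1] and all else to 1 is continuous, so the extension detects
    [iota (Some x0)]. *)
Lemma free_pro_nontrivial (gT : finGroupType) (x0 : X) :
  C gT -> (1 < #|[set: gT]%SET|)%N -> exists g : F, g != 1.
Proof.
move=> gC /card_gt1P[a [b [_ _ ab]]].
have [c c1] : exists c : gT, c != 1.
  by have [a1|] := eqVneq a 1; [exists b; rewrite -a1 eq_sym|exists a].
have [_ _ iota1 univ] := freeF.
pose f (x : one_point_compactification X) : discrete_topology gT :=
  if x == Some x0 then c else 1.
have fc : continuous f.
  apply/opc_continuousP => V /nbhs_singleton V1.
  apply: sub_finite_set (finite_set1 x0) => x /= nV.
  by apply: contrapT => xx0; apply: nV; rewrite /f; case: eqP => // -[].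
have [//|h [[_ hM hE] _]] := univ _ f (discrete_pro_group gC) fc.
exists (iota (Some x0)); apply: contra_neq c1 => iotax0.
have := congr1 (@^~ (Some x0)) hE; rewrite /f /= eqxx iotax0 => ->.
exact: morphM1.
Qed.

End FreeProGroup.

(** * The epimorphism as an ultrafilter limit *)

Theorem proposition35 (C : finGroupType -> Prop) (X : discreteTopologicalType)
    (F : topologicalGroupType) (iota : one_point_compactification X -> F)
    (varC : group_variety C)
    (ntC : exists2 gT : finGroupType, C gT & (1 < #|[set: gT]%SET|)%N)
    (infX : infinite_set [set: X])
    (freeF : is_free_pro_group C iota) :
  exists phi : F -> F,
    [/\ {morph phi : x y / x * y}, set_surj [set: F] [set: F] phi & ~ continuous phi].
Proof.
have [gT gC gT1] := ntC; have [proF iotac iota1 _] := freeF.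
have cptF := pro_group_compact proF; have hausF := pro_group_hausdorff proF.
have [e e_inj] := infinite_prod_nat_inj infX.
have /choice[b bP] : forall n, exists h : F -> F, [/\ continuous h,
    {morph h : x y / x * y} & forall y, h (iota (Some y)) = iota (Some (e (y, n)))].
  move=> n; apply: (free_pro_endo freeF (s := fun y => Some (e (y, n)))) => x y z [<-] [].
  by move=> /e_inj[].
have /choice[a aP] : forall n, exists h : F -> F, [/\ continuous h,
    {morph h : x y / x * y}, forall y, h (iota (Some (e (y, n)))) = iota (Some y)
    & forall x, (forall y, x <> e (y, n)) -> h (iota (Some x)) = 1].
  (* [s] is the partial inverse of [y |-> e (y, n)], with value [None] off the [n]-th copy. *)
  move=> n; have /choice[s sP] x : exists sx : option X,
      forall y, sx = Some y <-> x = e (y, n).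
    have [[y ->]|nx] := pselect (exists y, x = e (y, n)).
      by exists (Some y) => z; split=> [[->]//|/e_inj[->]].
    by exists None => y; split=> // xy; case: nx; exists y.
  have [|h [hc hM hE]] := free_pro_endo freeF (s := s).
    by move=> x y z /sP -> /sP ->.
  exists h; split=> // [y|x nx]; rewrite hE.
    by rewrite ((sP _ y).2 erefl).
  by case sx: (s x) => [z|//]; move/sP: sx => /nx.
(* Both sides are continuous homomorphisms in [f], so comparing them on generators suffices. *)
have ab n m f : a n (b m f) = if n == m then f else 1.
  have [ac aM aE a1] := aP n; have [bc bM bE] := bP m.
  have abc : continuous (a n \o b m).
    by move=> x; apply: continuous_comp; [exact: bc|exact: ac].
  have abM : {morph a n \o b m : x y / x * y} by move=> x y /=; rewrite bM aM.
  pose r (f : F) : F := if n == m then f else 1.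
  suff /(congr1 (@^~ f)) : a n \o b m = r by [].
  apply: (free_pro_hom_unique freeF) => //.
  - by rewrite /r; case: eqP => _; [move=> x; exact: cvg_id|exact: cst_continuous].
  - by move=> x y; rewrite /r; case: eqP => _ //; rewrite mulg1.
  - move=> x; rewrite /= bE /r; case: eqVneq => [<-//|nm].
    by apply: a1 => y /e_inj[_ mn]; rewrite mn eqxx in nm.
(* [U] refines [\oo], hence is nonprincipal: whatever holds for all large [n] holds along [U]. *)
have [U [UU oU]] := @ultraFilterLemma nat \oo _.
have /choice[phi phiP] : forall f, exists p : F, fmap (a^~ f) U --> p.
  by move=> f; exact: ultra_cvg.
have phiE f p : fmap (a^~ f) U --> p -> phi f = p.
  exact: cvg_unique (phiP f).
have phi_ev f p : (\forall n \near \oo, a n f = p) -> phi f = p.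
  move=> /oU afp; apply: phiE => V /nbhs_singleton Vp.
  by apply: (@filterS _ U _ _ _ _ afp) => n /= ->.
have phiM : {morph phi : x y / x * y}.
  move=> x y; apply: phiE.
  rewrite (_ : a^~ (x * y) = fun n => a n x * a n y); last first.
    by apply/funext => n; have [_ aM _ _] := aP n; rewrite aM.
  apply: (@continuous2_cvg _ _ _ _ _ _ _ _ mulg) (phiP x) (phiP y).
  exact: (@mulg_continuous F (phi x, phi y)).
have phi_surj : set_surj [set: F] [set: F] phi.
  move=> f _.
  pose g N := \prod_(i < N) b i f.
  (* [a n] kills every factor of [g N] except [b n f], which is present once [n < N]. *)
  have ag n N : (n < N)%N -> a n (g N) = f.
    have [_ aM _ _] := aP n.
    elim: N => // N IH; rewrite ltnS leq_eqVlt /g big_ord_recr /= aM ab.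
    case: eqVneq => [<- _|nN /= ltnN]; last by rewrite mulg1 IH.
    rewrite (big_morph _ aM (morphM1 aM)) big1 ?mul1g// => i _.
    by rewrite ab gtn_eqF.
  have [h hP] := ultra_cvg g UU cptF.
  exists h => //; apply: phi_ev; apply: nearW => n.
  have [ac aM _ _] := aP n.
  (* [a n (g N)] tends to [a n h] by continuity, and equals [f] for all [N > n]. *)
  apply: (@cvg_unique _ hausF (fmap (fun N => a n (g N)) U)).
    by apply: continuous_cvg hP; exact: ac.
  move=> V /nbhs_singleton Vf; apply: oU; exists n.+1 => // N /= nN.
  by rewrite ag.
exists phi; split=> // phic.
have phi1 : phi = fun=> 1.
  apply: (free_pro_hom_unique freeF) => //.
  + exact: cst_continuous.
  + by move=> x y; rewrite mulg1.
  + move=> x; apply: phi_ev.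
    have [[[y m] xym]|nx] := pselect (exists p, x = e p); last first.
      apply: nearW => n; have [_ _ _ a1] := aP n.
      by apply: a1 => y xyn; apply: nx; exists (y, n).
    (* The generator lies in the [m]-th copy alone, so [a n] kills it for every [n > m]. *)
    exists m.+1 => // n /= mn; have [_ _ _ a1] := aP n.
    by apply: a1 => z; rewrite xym => /e_inj[_ nm]; rewrite nm ltnn in mn.
have [x0 _] := infinite_setN0 infX.
have [f /eqP[]] := free_pro_nontrivial freeF x0 gC gT1.
by have [g _ <-] := phi_surj f I; rewrite phi1.
Qed.
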